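(* Let $K$ be a field and let $G$ be a finite simple graph without isolated vertices. Then the graded ring $K[E_G]/I(X_G)$ is one-dimensional and Cohen--Macaulay.
   Context: Graphs have nonempty vertex set. For a graph $G$ with vertex set $V_G$ and edge set $E_G$, let $K[V_G]=K[x_i: i\in V_G]$ and $K[E_G]=K[t_e: e\in E_G]$ be standard graded polynomial rings, and let $\theta\colon K[E_G]\to K[V_G]$ be the $K$-algebra homomorphism with $\theta(t_e)=x_ix_j$ for each edge $e=\{i,j\}$. The ideal $I(X_G)\subseteq K[E_G]$ is the (homogeneous) ideal $I(X_G)=\theta^{-1}\big((x_i^2-x_j^2 : i,j\in V_G)\big)$. *)

(* Defs.v *)
From HB Require Import structures.
From mathcomp Require Import all_boot all_algebra.
From mathcomp Require Import boolp.
From mathcomp Require Import ring mpoly.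

Set Implicit Arguments.
Unset Strict Implicit.
Unset Printing Implicit Defensive.

Import GRing.Theory.
Local Open Scope ring_scope.
Local Open Scope quotient_scope.

(* The types [idealr R] and [prime_idealr R] consist of proper ideals, given as
   boolean predicates; since classical logic is available, every proper ideal
   is of this form. *)

Section CommutativeAlgebra.
Variable R : comNzRingType.

Definition ideal_gen (s : seq R) (x : R) : Prop :=
  exists c : 'I_(size s) -> R, x = \sum_i c i * s`_i.

Definition ideal_closed (I : {pred R}) : Prop :=
  0 \in I /\ forall a, {in I &, forall u v, a * u + v \in I}.

Definition noetherian : Prop :=
  forall I : {pred R}, ideal_closed I ->
    exists s : seq R, forall x, x \in I <-> ideal_gen s x.

Definition maximal_ideal (m : idealr R) : Prop :=
  forall I : idealr R, {subset m <= I} -> {subset I <= m}.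

Definition prime_chain (n : nat) (p : 'I_n.+1 -> prime_idealr R) : Prop :=
  forall i j : 'I_n.+1, (i < j)%N ->
    {subset p i <= p j} /\ ~ {subset p j <= p i}.

Definition krull_dim (d : nat) : Prop :=
  (exists p : 'I_d.+1 -> prime_idealr R, prime_chain p) /\
  forall (n : nat) (p : 'I_n.+1 -> prime_idealr R),
    prime_chain p -> (n <= d)%N.

Definition regular_sequence (s : seq R) : Prop :=
  (forall (i : nat) (a : R), (i < size s)%N ->
     ideal_gen (take i s) (s`_i * a) -> ideal_gen (take i s) a) /\
  ~ ideal_gen s 1.

Definition depth (m : idealr R) (d : nat) : Prop :=
  (exists s : seq R,
     [/\ size s = d, {subset s <= m} & regular_sequence s]) /\
  forall s : seq R,
    {subset s <= m} -> regular_sequence s -> (size s <= d)%N.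

Definition local_ring (m : idealr R) : Prop :=
  forall I : idealr R, {subset I <= m}.

Definition depth_eq_dim : Prop :=
  exists m : idealr R, local_ring m /\
    exists d : nat, depth m d /\ krull_dim d.

End CommutativeAlgebra.

Section Localization.
Variables (R : comNzRingType) (p : prime_idealr R).

Definition denom : Type := {s : R | s \notin p}.

Lemma denom1_subproof : 1 \notin p.
Proof. by rewrite idealr1. Qed.

Lemma denomM_subproof (s t : denom) : sval s * sval t \notin p.
Proof. by rewrite prime_idealrM negb_or (svalP s) (svalP t). Qed.

Definition denom1 : denom := exist (fun s => s \notin p) 1 denom1_subproof.
Definition denomM (s t : denom) : denom :=
  exist (fun s => s \notin p) _ (denomM_subproof s t).

Definition fracs : Type := (R * denom)%type.
HB.instance Definition _ := Choice.on fracs.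

Definition loc_equiv (x y : fracs) : bool :=
  `[< exists u : denom, sval u * (x.1 * sval y.2 - y.1 * sval x.2) = 0 >].

Lemma loc_equiv_is_equiv : equiv_class_of loc_equiv.
Proof.
split=> [x|x y|y x z].
- by apply/asboolP; exists denom1; rewrite subrr mulr0.
- by apply/asboolP/asboolP => -[u hu]; exists u; rewrite -opprB mulrN hu oppr0.
- move=> /asboolP[u hu] /asboolP[v hv]; apply/asboolP.
  exists (denomM (denomM u v) y.2) => /=.
  have -> : sval u * sval v * sval y.2 * (x.1 * sval z.2 - z.1 * sval x.2) =
    sval v * sval z.2 * (sval u * (x.1 * sval y.2 - y.1 * sval x.2)) +
    sval u * sval x.2 * (sval v * (y.1 * sval z.2 - z.1 * sval y.2)) by ring.
  by rewrite hu hv !mulr0 addr0.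
Qed.

Canonical loc_equiv_equiv := EquivRelPack loc_equiv_is_equiv.
Canonical loc_equiv_encModRel := defaultEncModRel loc_equiv.

Definition localization := {eq_quot loc_equiv}.
HB.instance Definition _ : EqQuotient _ loc_equiv localization :=
  EqQuotient.on localization.
HB.instance Definition _ := Choice.on localization.

Lemma eq_locP (x y : fracs) :
  (exists u : denom, sval u * (x.1 * sval y.2 - y.1 * sval x.2) = 0) ->
  \pi_localization x = \pi_localization y.
Proof. by move=> h; apply/eqP; rewrite piE; apply/asboolP. Qed.

Lemma eq_locE (x y : fracs) :
  \pi_localization x = \pi_localization y ->
  exists u : denom, sval u * (x.1 * sval y.2 - y.1 * sval x.2) = 0.
Proof. by move/eqP; rewrite piE => /asboolP. Qed.

Definition frac_add (x y : fracs) : fracs :=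
  (x.1 * sval y.2 + y.1 * sval x.2, denomM x.2 y.2).
Definition frac_opp (x : fracs) : fracs := (- x.1, x.2).
Definition frac_mul (x y : fracs) : fracs := (x.1 * y.1, denomM x.2 y.2).

Definition loc_zero : localization := lift_cst localization ((0, denom1) : fracs).
Definition loc_one : localization := lift_cst localization ((1, denom1) : fracs).
Definition loc_add := lift_op2 localization frac_add.
Definition loc_opp := lift_op1 localization frac_opp.
Definition loc_mul := lift_op2 localization frac_mul.

Canonical pi_loc_zero_morph := PiConst loc_zero.
Canonical pi_loc_one_morph := PiConst loc_one.

Lemma pi_loc_opp : {morph \pi : x / frac_opp x >-> loc_opp x}.
Proof.
move=> x; unlock loc_opp; apply: eq_locP.
have [u hu] := eq_locE (esym (reprK (\pi_localization x))).
move: hu; set x' := repr _ => hu; exists u => /=.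
transitivity (- (sval u * (x.1 * sval x'.2 - x'.1 * sval x.2))); first by ring.
by rewrite hu oppr0.
Qed.
Canonical pi_loc_opp_morph := PiMorph1 pi_loc_opp.

Lemma pi_loc_add : {morph \pi : x y / frac_add x y >-> loc_add x y}.
Proof.
move=> x y; unlock loc_add; apply: eq_locP.
have [u] := eq_locE (esym (reprK (\pi_localization x))).
have [v] := eq_locE (esym (reprK (\pi_localization y))).
set x' := repr (\pi x); set y' := repr (\pi y) => hv hu.
exists (denomM u v) => /=.
transitivity (sval v * sval y.2 * sval y'.2 *
                (sval u * (x.1 * sval x'.2 - x'.1 * sval x.2)) +
              sval u * sval x.2 * sval x'.2 *
                (sval v * (y.1 * sval y'.2 - y'.1 * sval y.2))); first by ring.
by rewrite hu hv !mulr0 addr0.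
Qed.
Canonical pi_loc_add_morph := PiMorph2 pi_loc_add.

Lemma pi_loc_mul : {morph \pi : x y / frac_mul x y >-> loc_mul x y}.
Proof.
move=> x y; unlock loc_mul; apply: eq_locP.
have [u] := eq_locE (esym (reprK (\pi_localization x))).
have [v] := eq_locE (esym (reprK (\pi_localization y))).
set x' := repr (\pi x); set y' := repr (\pi y) => hv hu.
exists (denomM u v) => /=.
transitivity (sval v * y.1 * sval y'.2 *
                (sval u * (x.1 * sval x'.2 - x'.1 * sval x.2)) +
              sval u * x'.1 * sval x.2 *
                (sval v * (y.1 * sval y'.2 - y'.1 * sval y.2))); first by ring.
by rewrite hu hv !mulr0 addr0.
Qed.
Canonical pi_loc_mul_morph := PiMorph2 pi_loc_mul.

Lemma loc_addA : associative loc_add.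
Proof.
move=> x y z; rewrite -[x]reprK -[y]reprK -[z]reprK !piE.
by apply: eq_locP; exists denom1 => /=; ring.
Qed.

Lemma loc_addC : commutative loc_add.
Proof.
move=> x y; rewrite -[x]reprK -[y]reprK !piE.
by apply: eq_locP; exists denom1 => /=; ring.
Qed.

Lemma loc_add0 : left_id loc_zero loc_add.
Proof.
move=> x; rewrite -[x]reprK !piE.
by apply: eq_locP; exists denom1 => /=; ring.
Qed.

Lemma loc_addN : left_inverse loc_zero loc_opp loc_add.
Proof.
move=> x; rewrite -[x]reprK !piE.
by apply: eq_locP; exists denom1 => /=; ring.
Qed.

HB.instance Definition _ := GRing.isZmodule.Build localization
  loc_addA loc_addC loc_add0 loc_addN.

Lemma loc_mulA : associative loc_mul.
Proof.
move=> x y z; rewrite -[x]reprK -[y]reprK -[z]reprK !piE.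
by apply: eq_locP; exists denom1 => /=; ring.
Qed.

Lemma loc_mulC : commutative loc_mul.
Proof.
move=> x y; rewrite -[x]reprK -[y]reprK !piE.
by apply: eq_locP; exists denom1 => /=; ring.
Qed.

Lemma loc_mul1 : left_id loc_one loc_mul.
Proof.
move=> x; rewrite -[x]reprK !piE.
by apply: eq_locP; exists denom1 => /=; ring.
Qed.

Lemma loc_mulDl : left_distributive loc_mul loc_add.
Proof.
move=> x y z; rewrite -[x]reprK -[y]reprK -[z]reprK !piE.
by apply: eq_locP; exists denom1 => /=; ring.
Qed.

Lemma loc_one_neq0 : loc_one != loc_zero.
Proof.
apply/eqP; rewrite !piE => /eq_locE[u] /=.
by rewrite mulr1 mul0r subr0 mulr1 => u0; have := svalP u; rewrite u0 idealr0.
Qed.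

HB.instance Definition _ := GRing.Zmodule_isComNzRing.Build localization
  loc_mulA loc_mulC loc_mul1 loc_mulDl loc_one_neq0.

End Localization.

(* Maximal ideals are prime, so that the quantification below is over all
   maximal ideals. *)
Definition cohen_macaulay (R : comNzRingType) : Prop :=
  noetherian R /\
  forall m : prime_idealr R, maximal_ideal m ->
    depth_eq_dim (localization m).

Section EdgeRing.
Variables (K : fieldType) (V : finType) (e : rel V).

Definition edges : {set {set V}} :=
  [set [set ij.1; ij.2] | ij : V * V & e ij.1 ij.2].

(* K[V] and K[E] have variables indexed by 'I_#|V| and 'I_#|edges|, through
   [enum_rank] and [enum_val]. *)
Definition vertex_var (i : V) : {mpoly K[#|V|]} := 'X_(enum_rank i).

Definition theta (p : {mpoly K[#|edges|]}) : {mpoly K[#|V|]} :=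
  p \mPo [tuple \prod_(i in enum_val k) vertex_var i | k < #|edges|].

Lemma thetaX (k : 'I_#|edges|) (i j : V) :
  irreflexive e -> e i j -> enum_val k = [set i; j] ->
  theta 'X_k = vertex_var i * vertex_var j.
Proof.
move=> irr eij kE; rewrite /theta comp_mpolyXU -tnth_nth tnth_mktuple kE.
rewrite big_setU1 ?big_set1 // inE.
by apply/eqP=> ij; rewrite ij irr in eij.
Qed.

Definition square_differences : seq {mpoly K[#|V|]} :=
  [seq vertex_var i ^+ 2 - vertex_var j ^+ 2 | i <- enum V, j <- enum V].

Definition IX_pred : {pred {mpoly K[#|edges|]}} :=
  fun p => `[< ideal_gen square_differences (theta p) >].

Lemma IX_idealr_closed : idealr_closed IX_pred.
Proof.
split.
- apply/asboolP; exists (fun=> 0).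
  by rewrite /theta raddf0 big1 // => i _; rewrite mul0r.
- apply/asboolP => -[c]; rewrite /theta rmorph1.
  move=> /(congr1 (meval (fun=> 0))); rewrite rmorph1 rmorph_sum /= big1.
    by move/eqP; rewrite oner_eq0.
  move=> i _; rewrite rmorphM /=.
  suff -> : meval (fun=> 0) square_differences`_i = 0 by rewrite mulr0.
  have := mem_nth 0 (ltn_ord i); set x := _`_i => /allpairsP[[a b] [_ _ ->]] /=.
  by rewrite rmorphB !rmorphXn /= !mevalXU subrr.
- move=> a u v /asboolP[c hc] /asboolP[d hd]; apply/asboolP.
  exists (fun i => theta a * c i + d i).
  rewrite /theta rmorphD rmorphM /= -!/(theta _) hc hd mulr_sumr -big_split /=.
  by apply: eq_bigr => i _; rewrite mulrDl mulrA.
Qed.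

HB.instance Definition _ := isIdealr.Build _ IX_pred IX_idealr_closed.
Definition IX : idealr {mpoly K[#|edges|]} := IX_pred.

Definition edge_quotient : comNzRingType := {ideal_quot IX}.
End EdgeRing.

(* Main.v *)
From HB Require Import structures.
Require Import Defs.
From mathcomp Require Import boolp classical_sets.
From mathcomp Require Import ssrcomplements mpoly bigenough.
From mathcomp Require Import all_boot all_algebra ring.

(* Write A = K[V]/(x_i^2 - x_j^2). All the x_i^2 have the same image y in A, and
   A is a free K[y]-module on the squarefree monomials. Hence the quotient R of
   K[E] embeds in A, and all the t_e^2 have the same image z = y^2 in R. So R is
   generated as a K[z]-module by the squarefree monomials in the t_e, and it is
   torsion free over the polynomial ring K[z]. A ring that is finite and torsion
   free over K[z] is noetherian and of dimension one, and every maximal ideal of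
   it contains a nonzero polynomial in z, which is a nonzerodivisor; so its
   localizations at maximal ideals have depth one. *)

Set Implicit Arguments.
Unset Strict Implicit.
Unset Printing Implicit Defensive.

Import GRing.Theory BigEnough.
Local Open Scope ring_scope.
Local Open Scope quotient_scope.

(** * Existence of prime ideals, chains of primes, and depth of local rings *)

Section PrimeIdeals.
Variable R : comNzRingType.

Definition ideal_lt (p q : {pred R}) : Prop :=
  {subset p <= q} /\ ~ {subset q <= p}.

Lemma ideal_ltP (p q : {pred R}) :
  ideal_lt p q <-> {subset p <= q} /\ exists2 x, x \in q & x \notin p.
Proof.
split=> -[pq h]; split=> //.
  apply: contrapT => nx; apply: h => x xq.
  by apply/negPn/negP => xp; apply: nx; exists x.
by case: h => x xq /negP xp qp; apply/xp/qp.
Qed.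

Lemma ideal_closed0 : ideal_closed (pred1 (0 : R)).
Proof.
split=> [|a u v]; rewrite !inE // => /eqP-> /eqP->.
by rewrite mulr0 addr0.
Qed.

Lemma idealr_ideal_closed (I : idealr R) : ideal_closed I.
Proof. by split=> [|a u v uI vI]; rewrite ?idealr0 // rpredD // idealMr. Qed.

Lemma ideal_closedM (I : {pred R}) a u :
  ideal_closed I -> u \in I -> a * u \in I.
Proof. by case=> I0 h uI; rewrite -[_ * _]addr0 h. Qed.

Lemma ideal_closedD (I : {pred R}) u v :
  ideal_closed I -> u \in I -> v \in I -> u + v \in I.
Proof. by case=> I0 h uI vI; rewrite -[u]mul1r h. Qed.

(** Zorn's lemma for the sets [A] whose union with [I] is an ideal disjoint from [S]. Taking the
    union with [I] makes the empty chain harmless: its union yields [I] itself. *)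
Lemma exists_maximal_avoiding (I : {pred R}) (S : R -> Prop) :
  ideal_closed I -> (forall x, S x -> x \notin I) ->
  exists2 J : {pred R},
    [/\ ideal_closed J, {subset I <= J} & forall x, S x -> x \notin J] &
    forall J' : {pred R}, ideal_closed J' -> {subset J <= J'} ->
      (forall x, S x -> x \notin J') -> {subset J' <= J}.
Proof.
move=> Iid IS.
pose ext (A : set R) : {pred R} := fun x => `[< A x \/ x \in I >].
pose P (A : set R) := ideal_closed (ext A) /\ forall x, S x -> x \notin ext A.
have extP A x : reflect (A x \/ x \in I) (x \in ext A) by apply: asboolP.
have [|A [[Aid AS] Amax]] := @Zorn_bigcup R P.
  move=> F FP Ftot; split; last first.
    move=> x Sx; apply/extP => -[[A FA Ax]|]; last exact/negP/IS.
    by have [_ /(_ x Sx)/extP] := FP _ FA; apply; left.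
  split; first by apply/extP; right; case: Iid.
  have sub A x : F A -> x \in ext A -> x \in ext (\bigcup_(X in F) X)%classic.
    by move=> FA /extP[Ax|xI]; apply/extP; [left; exists A|right].
  have ext1 A x : A x -> x \in ext A by move=> Ax; apply/extP; left.
  have extI A x : x \in I -> x \in ext A by move=> Ax; apply/extP; right.
  move=> a u v /extP[[A FA Au]|uI] /extP[[B FB Bv]|vI].
  - have [AB|BA] := Ftot _ _ FA FB.
      apply: (sub B _ FB); have [[_ h] _] := FP _ FB.
      by apply: h; apply: ext1 => //; apply: AB.
    apply: (sub A _ FA); have [[_ h] _] := FP _ FA.
    by apply: h; apply: ext1 => //; apply: BA.
  - by apply: (sub A _ FA); have [[_ h] _] := FP _ FA; apply: h; auto.
  - by apply: (sub B _ FB); have [[_ h] _] := FP _ FB; apply: h; auto.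
  - by apply: extI; case: Iid => _; apply.
exists (ext A); first by split=> // x xI; apply/extP; right.
move=> J' J'id AJ' J'S x xJ'.
apply/negPn/negP => xA; apply: (Amax [set` J']%classic); last first.
  have extE : ext [set` J']%classic =i J'.
    move=> z; apply/extP/idP => [[//|zI]|zJ']; last by left.
    by apply: AJ'; apply/extP; right.
  split=> [|z Sz]; last by rewrite extE J'S.
  split; first by rewrite extE; case: J'id.
  by move=> a u v; rewrite !extE; case: J'id => _; apply.
split=> [z Az|h]; first by apply/AJ'/extP; left.
by move/negP: xA; apply; apply/extP; left; apply: h.
Qed.

(** If u and v lie outside a maximal such ideal J, then J + (u) and J + (v) both meet [S]. The
    product of the two common elements is in [S], and would be in J if uv were. *)
Lemma exists_prime_avoiding (I : {pred R}) (S : R -> Prop) :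
  ideal_closed I -> S 1 -> (forall x y, S x -> S y -> S (x * y)) ->
  (forall x, S x -> x \notin I) ->
  exists p : prime_idealr R,
    [/\ {subset I <= p}, forall x, S x -> x \notin p &
     forall q : idealr R, {subset p <= q} -> (forall x, S x -> x \notin q) ->
       {subset q <= p}].
Proof.
move=> Iid S1 SM IS.
have [J [Jid IJ JS] Jmax] := exists_maximal_avoiding Iid IS.
have Jidr : idealr_closed J by split; [case: Jid|apply: JS|case: Jid].
have meet u : u \notin J -> exists a b, [/\ a \in J & S (a + b * u)].
  move=> uJ; apply: contrapT => no.
  pose Ju : {pred R} := fun x => `[< exists a b, a \in J /\ x = a + b * u >].
  move/negP: uJ; apply; apply: (Jmax Ju).
  - split; first by apply/asboolP; exists 0, 0; rewrite mul0r addr0; case: Jid.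
    move=> c _ _ /asboolP[a [b [aJ ->]]] /asboolP[a' [b' [a'J ->]]].
    apply/asboolP; exists (c * a + a'), (c * b + b').
    by split; [case: Jid => _; apply|ring].
  - by move=> x xJ; apply/asboolP; exists x, 0; rewrite mul0r addr0.
  - move=> x Sx; apply/asboolP => -[a [b [aJ xE]]].
    by apply: no; exists a, b; rewrite -xE.
  - by apply/asboolP; exists 0, 1; rewrite mul1r add0r; case: Jid.
have Jprime : prime_idealr_closed J.
  move=> u v uvJ; apply/negPn/negP; rewrite negb_or => /andP[uJ vJ].
  have [a [b [aJ Sab]]] := meet _ uJ; have [a' [b' [a'J Sab']]] := meet _ vJ.
  have /negP := JS _ (SM _ _ Sab Sab'); apply.
  have -> : (a + b * u) * (a' + b' * v) =
    (a' + b' * v) * a + (b * u * a' + (b * b') * (u * v)) by ring.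
  by do 2?[apply: ideal_closedD => //]; apply: ideal_closedM.
pose p : prime_idealr R := HB.pack J (isIdealr.Build R J Jidr)
  (isPrimeIdealrClosed.Build R J Jprime).
exists p; split=> // q pq qS; apply: Jmax => //; exact: idealr_ideal_closed.
Qed.

Lemma exists_maximal_above (I : {pred R}) :
  ideal_closed I -> 1 \notin I ->
  exists2 p : prime_idealr R, {subset I <= p} & maximal_ideal p.
Proof.
move=> Iid I1.
have [//|_ _ -> ->|_ -> //|p [Ip _ pmax]] :=
  @exists_prime_avoiding I (fun x => x = 1) Iid.
  by rewrite mulr1.
by exists p => // q pq; apply: pmax => // _ ->; rewrite idealr1.
Qed.

Definition dim_le1 : Prop :=
  forall p q r : prime_idealr R, ideal_lt p q -> ideal_lt q r -> False.

Lemma dim_le1_prime_chain n (p : 'I_n.+1 -> prime_idealr R) :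
  dim_le1 -> prime_chain p -> (n <= 1)%N.
Proof.
move=> dim pc; rewrite leqNgt; apply/negP => n1.
apply: (dim (p (inord 0)) (p (inord 1)) (p (inord 2))); apply: pc;
  by rewrite !inordK // ltnS (leq_trans _ n1).
Qed.

Lemma krull_dim1 (p q : prime_idealr R) :
  dim_le1 -> ideal_lt p q -> krull_dim R 1.
Proof.
move=> dim pq; split; last by move=> n c; apply: dim_le1_prime_chain.
exists (fun i : 'I_2 => if i == ord0 then p else q).
by move=> [[|[|//]] ?] [[|[|//]] ?].
Qed.

Lemma ideal_gen_nil (x : R) : ideal_gen [::] x <-> x = 0.
Proof.
split=> [[c ->]|->]; first by rewrite big_ord0.
by exists (fun=> 0); rewrite big_ord0.
Qed.

Lemma ideal_gen_seq1 (a x : R) : ideal_gen [:: a] x <-> exists c, x = c * a.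
Proof.
split=> [[c ->]|[c ->]]; first by exists (c ord0); rewrite big_ord1.
by exists (fun=> c); rewrite big_ord1.
Qed.

Lemma ideal_gen_closed (s : seq R) (I : {pred R}) x :
  ideal_closed I -> {subset s <= I} -> ideal_gen s x -> x \in I.
Proof.
move=> Iid sI [c ->]; elim/big_ind: _ => [|u v|i _]; first by case: Iid.
  exact: ideal_closedD.
by apply: ideal_closedM => //; apply/sI/mem_nth.
Qed.

(* If [a, b] begins a regular sequence then no power of [b] lies in [(a)], so
   some prime [q] contains [a] and avoids [b]; as [a] is a nonzerodivisor, some
   prime inside [q] avoids [a]. *)
Lemma regular_sequence_size (m : idealr R) (s : seq R) :
  local_ring m -> dim_le1 -> {subset s <= m} -> regular_sequence s ->
  (size s <= 1)%N.
Proof.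
move=> loc dim sm [reg]; case: s sm reg => [|a [|b s]] // sm reg _.
have am : a \in m by apply: sm; rewrite inE eqxx.
have bm : b \in m by apply: sm; rewrite !inE eqxx orbT.
have a_reg x : a * x = 0 -> x = 0.
  by move=> /ideal_gen_nil/(reg 0%N x isT)/ideal_gen_nil.
have b_reg x : (exists c, b * x = c * a) -> exists c, x = c * a.
  by move=> /ideal_gen_seq1/(reg 1%N x isT)/ideal_gen_seq1.
(* Regularity cancels one factor [b] modulo ([a]) at a time, down to 1 in ([a]), which [m]
   excludes. *)
have bk k : ~ exists c, b ^+ k = c * a.
  elim: k => [[c]|k IHk]; last by rewrite exprS => /b_reg/IHk.
  by move=> /esym c1; have := idealr1 m; rewrite -(expr0 b) -c1 idealMr.
pose aR : {pred R} := fun x => `[< exists c, x = c * a >].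
have [||_ _ [k ->] [l ->]|x [k ->]|q [aq bq _]] :=
  @exists_prime_avoiding aR (fun x => exists k, x = b ^+ k).
- split; first by apply/asboolP; exists 0; rewrite mul0r.
  move=> c _ _ /asboolP[u ->] /asboolP[v ->]; apply/asboolP.
  by exists (c * u + v); ring.
- by exists 0%N.
- by exists (k + l)%N; rewrite exprD.
- exact/asboolP/bk.
(* The set contains both the complement of [q] and the powers of [a], so a prime avoiding it lies
   inside [q] and misses [a]. *)
have [||x y|x|p [_ pS _]] := @exists_prime_avoiding (pred1 0)
  (fun x => exists k u, u \notin q /\ x = a ^+ k * u).
- exact: ideal_closed0.
- by exists 0%N, 1; rewrite idealr1 expr0 mulr1.
- move=> [k [u [uq ->]]] [l [v [vq ->]]]; exists (k + l)%N, (u * v).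
  by rewrite prime_idealrM negb_or uq vq exprD; split=> //; ring.
- move=> [k [u [uq ->]]]; rewrite inE; apply/eqP => aku.
  suff u0 : u = 0 by rewrite u0 idealr0 in uq.
  elim: k aku => [|k IHk]; first by rewrite mul1r.
  by rewrite exprS -mulrA => /a_reg.
(* [m] is given only as a proper ideal; a maximal ideal above it supplies the top prime of the
   chain. *)
have [||r mr _] := @exists_maximal_above m.
- exact: idealr_ideal_closed.
- by rewrite idealr1.
exfalso; apply: (dim p q r); apply/ideal_ltP; split.
- move=> x xp; apply/negPn/negP => xq.
  suff /negP/(_ xp) : x \notin p by [].
  by apply: pS; exists 0%N, x; rewrite mul1r.
- exists a; first by apply: aq; apply/asboolP; exists 1; rewrite mul1r.
  by apply: pS; exists 1%N, 1; rewrite idealr1 mulr1.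
- by move=> x xq; apply/mr/(loc q).
- by exists b; [apply: mr|apply: bq; exists 1%N].
Qed.

Lemma depth1 (m : idealr R) (a : R) :
  local_ring m -> dim_le1 -> a \in m -> (forall x, a * x = 0 -> x = 0) ->
  depth m 1.
Proof.
move=> loc dim am a_reg; split; last by move=> s; apply: regular_sequence_size.
exists [:: a]; split=> [//|x|]; first by rewrite inE => /eqP->.
split=> [[|//] x _ /ideal_gen_nil/a_reg/ideal_gen_nil //|].
move=> /ideal_gen_seq1[c c1].
by have := idealr1 m; rewrite c1 idealMr.
Qed.

End PrimeIdeals.

(** * Contraction of primes along a ring homomorphism *)

Section PrimePreimage.
Variables (A B : comNzRingType) (f : {rmorphism A -> B}) (q : prime_idealr B).

Definition preim_ideal : {pred A} := fun x => f x \in q.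

Lemma mem_preim_ideal x : (x \in preim_ideal) = (f x \in q).
Proof. by []. Qed.

Lemma preim_idealr_closed : idealr_closed preim_ideal.
Proof.
split; rewrite ?mem_preim_ideal ?rmorph0 ?rmorph1 ?idealr0 ?idealr1 //.
move=> a u v; rewrite !mem_preim_ideal rmorphD rmorphM => uq vq.
by rewrite rpredD // idealMr.
Qed.

Lemma preim_prime_closed : prime_idealr_closed preim_ideal.
Proof. by move=> u v; rewrite !mem_preim_ideal rmorphM prime_idealrM. Qed.

HB.instance Definition _ := isIdealr.Build A preim_ideal preim_idealr_closed.
HB.instance Definition _ :=
  isPrimeIdealrClosed.Build A preim_ideal preim_prime_closed.

Definition preim_prime : prime_idealr A := preim_ideal.

Lemma mem_preim_prime x : (x \in preim_prime) = (f x \in q).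
Proof. by []. Qed.

End PrimePreimage.

(** * Localization at a prime: fractions, maximal ideal, dimension *)

Section LocalizationTheory.
Variables (R : comNzRingType) (p : prime_idealr R).
Local Notation Rp := (localization p).

Definition to_loc (x : R) : Rp := \pi_Rp (x, denom1 p).

Lemma to_loc_zmod : zmod_morphism to_loc.
Proof.
move=> x y; rewrite /to_loc -[RHS]/(loc_add _ (loc_opp _)) !piE.
by apply: eq_locP; exists (denom1 p) => /=; ring.
Qed.

Lemma to_loc_monoid : monoid_morphism to_loc.
Proof.
split=> [|x y]; rewrite /to_loc.
  by rewrite -[RHS]/(loc_one p) !piE.
rewrite -[RHS]/(loc_mul _ _) !piE.
by apply: eq_locP; exists (denom1 p) => /=; ring.
Qed.

HB.instance Definition _ := GRing.isZmodMorphism.Build R Rp to_loc to_loc_zmod.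
HB.instance Definition _ :=
  GRing.isMonoidMorphism.Build R Rp to_loc to_loc_monoid.

Lemma to_loc_eq0 x : to_loc x = 0 -> exists2 u, u \notin p & u * x = 0.
Proof.
rewrite /to_loc -[RHS]/(loc_zero p) !piE => /eq_locE[[u up] /=].
by rewrite !mulr1 subr0; exists u.
Qed.

Lemma to_loc_unit s : s \notin p -> exists t, to_loc s * t = 1.
Proof.
move=> sp; exists (\pi_Rp (1, exist _ s sp)).
rewrite -[LHS]/(loc_mul _ _) -[RHS]/(loc_one p) !piE.
by apply: eq_locP; exists (denom1 p) => /=; ring.
Qed.

Lemma loc_fracP (z : Rp) :
  exists x s, s \notin p /\ z * to_loc s = to_loc x.
Proof.
have [x [[s sp] <-]] : exists x (s : denom p), \pi_Rp (x, s) = z.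
  by exists (repr z).1, (repr z).2; rewrite -surjective_pairing reprK.
exists x, s; split=> //.
rewrite -[LHS]/(loc_mul _ _) !piE.
by apply: eq_locP; exists (denom1 p) => /=; ring.
Qed.

Lemma to_loc_regular a (z : Rp) :
  (forall x, a * x = 0 -> x = 0) -> to_loc a * z = 0 -> z = 0.
Proof.
move=> areg az; have [x [s [sp zs]]] := loc_fracP z.
have [u up uax] : exists2 u, u \notin p & u * (a * x) = 0.
  by apply: to_loc_eq0; rewrite rmorphM /= -zs mulrA az mul0r.
have [t st] := to_loc_unit sp; have [v uv] := to_loc_unit up.
(* [t] and [v] invert [s] and [u], so z = x/s = (ux)/(us), and [a] kills the numerator ux already in
   [R]. *)
have -> : z = v * t * to_loc (u * x).
  by rewrite rmorphM /= -zs -[LHS]mulr1 -[1]mulr1 -{1}st -uv; ring.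
have -> : u * x = 0 by apply: areg; rewrite -uax; ring.
by rewrite rmorph0 mulr0.
Qed.

Lemma mem_loc_ideal (I : idealr Rp) z x s :
  s \notin p -> z * to_loc s = to_loc x -> (z \in I) = (to_loc x \in I).
Proof.
move=> sp zs; rewrite -zs; apply/idP/idP => [zI|zsI].
  by rewrite mulrC idealMr.
by have [t st] := to_loc_unit sp; rewrite -[z]mulr1 -st mulrA mulrC idealMr.
Qed.

(** The extension of [p] to the localization. One presentation with numerator in [p] suffices, so no
    choice of representative enters. *)
Definition loc_max : {pred Rp} :=
  fun z =>
    `[< exists x s, [/\ x \in p, s \notin p & z * to_loc s = to_loc x] >].

Lemma loc_max_idealr_closed : idealr_closed loc_max.
Proof.
split.
- apply/asboolP; exists 0, 1.
  by rewrite idealr0 idealr1 mul0r rmorph0.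
- apply/asboolP => -[x [s [xp sp]]]; rewrite mul1r => /eqP.
  rewrite -subr_eq0 -rmorphB => /eqP/to_loc_eq0[u up us].
  have : u * (s - x) \in p by rewrite us idealr0.
  rewrite prime_idealrM (negPf up) /= => sxp.
  by move: sp; rewrite -[s](subrK x) rpredD.
- move=> a z z' /asboolP[x [s [xp sp zs]]] /asboolP[x' [s' [xp' sp' zs']]].
  have [y [t [tp at_]]] := loc_fracP a.
  apply/asboolP; exists (y * s' * x + t * s * x'), (t * s * s'); split.
  + by rewrite rpredD // idealMr.
  + by rewrite !prime_idealrM !negb_or tp sp sp'.
  + by rewrite rmorphD !rmorphM /= -at_ -zs -zs'; ring.
Qed.

HB.instance Definition _ := isIdealr.Build Rp loc_max loc_max_idealr_closed.

(** A fraction with numerator outside [p] is a unit, so it lies in no proper ideal. *)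
Lemma loc_max_local : local_ring (loc_max : idealr Rp).
Proof.
move=> I z zI; have [x [s [sp zs]]] := loc_fracP z.
apply/asboolP; exists x, s; split=> //; apply/negPn/negP => xp.
have [t xt] := to_loc_unit xp; have := idealr1 I.
by rewrite -xt mulrC idealMr // -(mem_loc_ideal I sp zs).
Qed.

Lemma to_loc_max x : x \in p -> to_loc x \in loc_max.
Proof.
move=> xp; apply/asboolP; exists x, 1.
by rewrite idealr1 rmorph1 mulr1.
Qed.

(** Strictness survives contraction: clearing the denominator of a separating element multiplies it
    by a unit. *)
Lemma preim_to_loc_lt (q q' : prime_idealr Rp) :
  ideal_lt q q' -> ideal_lt (preim_prime to_loc q) (preim_prime to_loc q').
Proof.
move=> /ideal_ltP[qq' [z zq' zq]]; apply/ideal_ltP; split=> [x|].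
  by rewrite !mem_preim_prime => /qq'.
have [x [s [sp zs]]] := loc_fracP z; exists x; rewrite mem_preim_prime.
  by rewrite -(mem_loc_ideal q' sp zs).
by rewrite -(mem_loc_ideal q sp zs).
Qed.

Lemma loc_dim_le1 : dim_le1 R -> dim_le1 Rp.
Proof.
by move=> dim q q' q'' /preim_to_loc_lt lt1 /preim_to_loc_lt; apply: dim lt1.
Qed.

End LocalizationTheory.

Arguments loc_max [R] p _.

(** * Finitely generated modules and integrality *)

Section ModuleSpan.
Variables (B R : comNzRingType) (phi : {rmorphism B -> R}).

Definition module_span (s : seq R) (x : R) : Prop :=
  exists c : 'I_(size s) -> B, x = \sum_i phi (c i) * s`_i.

Lemma module_span_nil x : module_span [::] x <-> x = 0.
Proof.
split=> [[c ->]|->]; first by rewrite big_ord0.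
by exists (fun=> 0); rewrite big_ord0.
Qed.

Lemma module_span_cons a s x :
  module_span (a :: s) x <->
  exists b y, module_span s y /\ x = phi b * a + y.
Proof.
split=> [[c ->]|[b [_ [[c ->] ->]]]].
  rewrite big_ord_recl; exists (c ord0), (\sum_i phi (c (lift ord0 i)) * s`_i).
  by split=> //; exists (fun i => c (lift ord0 i)).
exists (fun i => if unlift ord0 i is Some j then c j else b).
rewrite big_ord_recl unlift_none; congr (_ + _).
by apply: eq_bigr => i _; rewrite liftK.
Qed.

Lemma module_spanD s x y :
  module_span s x -> module_span s y -> module_span s (x + y).
Proof.
move=> [c ->] [d ->]; exists (fun i => c i + d i).
by rewrite -big_split; apply: eq_bigr => i _; rewrite rmorphD mulrDl.
Qed.

Lemma module_spanM s b x : module_span s x -> module_span s (phi b * x).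
Proof.
move=> [c ->]; exists (fun i => b * c i).
by rewrite mulr_sumr; apply: eq_bigr => i _; rewrite rmorphM mulrA.
Qed.

Lemma module_span0 s : module_span s 0.
Proof. by exists (fun=> 0); rewrite big1 // => i _; rewrite rmorph0 mul0r. Qed.

Lemma mem_module_span s x : x \in s -> module_span s x.
Proof.
move=> /(nthP 0)[i lti <-]; exists (fun j => (j == Ordinal lti)%:R).
rewrite (bigD1 (Ordinal lti)) //= eqxx rmorph1 mul1r.
rewrite big1 ?addr0 // => j /negPf->.
by rewrite rmorph0 mul0r.
Qed.

Lemma module_span_ideal_gen s x : module_span s x -> ideal_gen s x.
Proof. by move=> [c ->]; exists (fun i => phi (c i)). Qed.

(* Cayley-Hamilton, applied to the matrix of multiplication by [x]. *)
Lemma module_finite_integral (s : seq R) :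
  (forall x, module_span s x) -> integralRange phi.
Proof.
move=> gen x.
have /choice[c cE] (i : 'I_(size s)) : exists c : 'I_(size s) -> B,
  x * s`_i = \sum_j phi (c j) * s`_j by apply: gen.
pose A := \matrix_(i, j) c i j.
exists (char_poly A); first exact: char_poly_monic.
pose N : 'M[R]_(size s) := x%:M - map_mx phi A.
pose w : 'cV[R]_(size s) := \col_i s`_i.
have Nw : N *m w = 0.
  apply/colP => i; rewrite mulmxBl mul_scalar_mx !mxE cE.
  by apply/subr0_eq; rewrite subr0 -sumrB big1 // => j _; rewrite !mxE subrr.
have detN (i : 'I_(size s)) : \det N * s`_i = 0.
  have : (\adj N *m N) *m w = 0 by rewrite -mulmxA Nw mulmx0.
  rewrite mul_adj_mx mul_scalar_mx => /colP/(_ i).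
  by rewrite !mxE.
have -> : root (map_poly phi (char_poly A)) x = (\det N == 0).
  rewrite map_char_poly /root /char_poly -horner_evalE -det_map_mx.
  congr (\det _ == 0); apply/matrixP => i j.
  by rewrite !mxE /= horner_evalE !hornerE hornerMn hornerX.
(* The determinant kills every generator, hence also 1, which is a combination of them. *)
have [d d1] := gen 1; rewrite -[\det N]mulr1 d1 mulr_sumr big1 // => i _.
by rewrite mulrCA detN mulr0.
Qed.

End ModuleSpan.

(** * Rings that are finite and torsion free over a polynomial ring K[z] *)

Section PolynomialModules.
Variables (K : fieldType) (R : comNzRingType) (phi : {rmorphism {poly K} -> R}).

Lemma poly_ideal_principal (J : {pred {poly K}}) :
  ideal_closed J -> exists2 g, g \in J & forall f, f \in J -> g %| f.
Proof.
move=> Jid.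
have [[f [fJ f0]]|J0] := pselect (exists f, f \in J /\ f != 0); last first.
  exists 0 => [|f fJ]; first by case: Jid.
  by rewrite dvd0p; apply/negPn/negP => f0; apply: J0; exists f.
have ex : exists n, `[< exists g, [/\ g \in J, g != 0 & size g = n] >].
  by exists (size f); apply/asboolP; exists f.
case: (ex_minnP ex) => n /asboolP[g [gJ g0 <-]] gmin.
exists g => // h hJ; apply/negPn/negP => gh.
have : h %% g \in J.
  rewrite -[h %% g](addKr (h %/ g * g)) -divp_eq addrC -mulNr -[h]mul1r addrC.
  by apply: ideal_closedD => //; apply: ideal_closedM.
move=> modJ; have := gmin (size (h %% g)); rewrite leqNgt ltn_modp g0.
move=> /(_ _)/negP; apply=> //; apply/asboolP; exists (h %% g).
by rewrite /dvdp in gh.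
Qed.

Definition submodule_closed (M : {pred R}) : Prop :=
  0 \in M /\ forall b, {in M &, forall u v, phi b * u + v \in M}.

(** Induction on the generators: the coefficients of [a] in elements of [M] form a principal ideal
    (g). Subtracting a multiple of one element of [M] with coefficient g leaves an element of [M]
    spanned by the remaining generators. *)
Lemma submodule_finite (s : seq R) (M : {pred R}) :
  submodule_closed M -> (forall x, x \in M -> module_span phi s x) ->
  exists t : seq R, {subset t <= M} /\ forall x, x \in M -> module_span phi t x.
Proof.
elim: s M => [|a s IHs] M Mcl Ms.
  exists [::]; split=> // x /Ms/module_span_nil->; exact: module_span0.
have [M0 Mlin] := Mcl.
pose J : {pred {poly K}} :=
  fun b => `[< exists2 y, module_span phi s y & phi b * a + y \in M >].
have Jid : ideal_closed J.
  split.
    apply/asboolP; exists 0; first exact: module_span0.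
    by rewrite rmorph0 mul0r add0r.
  move=> b f f' /asboolP[y sy My] /asboolP[y' sy' My'].
  apply/asboolP; exists (phi b * y + y').
    by apply: module_spanD => //; apply: module_spanM.
  have -> : phi (b * f + f') * a + (phi b * y + y') =
    phi b * (phi f * a + y) + (phi f' * a + y').
    by rewrite rmorphD rmorphM; ring.
  exact: Mlin.
have [g /asboolP[y0 sy0 My0] gJ] := poly_ideal_principal Jid.
pose M' : {pred R} := fun x => `[< x \in M /\ module_span phi s x >].
have [||t [tM' M't]] := IHs M'.
- split=> [|b u v /asboolP[uM us] /asboolP[vM vs]]; apply/asboolP.
    by split=> //; apply: module_span0.
  split; first exact: Mlin.
  by apply: module_spanD => //; apply: module_spanM.
- by move=> x /asboolP[].
exists (phi g * a + y0 :: t); split=> [x|x xM].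
  by rewrite inE => /predU1P[->//|/tM'/asboolP[]].
have /module_span_cons[b [y [sy xE]]] := Ms x xM.
have /dvdpP[q bE] : g %| b by apply: gJ; apply/asboolP; exists y; rewrite -?xE.
apply/module_span_cons; exists q, (- phi q * y0 + y); split; last first.
  by rewrite xE bE rmorphM; ring.
apply: M't; apply/asboolP; split.
  have -> : - phi q * y0 + y = phi (- q) * (phi g * a + y0) + x.
    by rewrite xE bE rmorphN rmorphM; ring.
  exact: Mlin.
by rewrite -rmorphN; apply: module_spanD => //; apply: module_spanM.
Qed.

Hypothesis phi_regular : forall f x, f != 0 -> phi f * x = 0 -> x = 0.
Variable s : seq R.
Hypothesis gen : forall x, module_span phi s x.

(** An ideal is a K[z]-submodule, and its module generators also generate it as an ideal. *)
Lemma finite_noetherian : noetherian R.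
Proof.
move=> I Iid; have [|//|t [tI It]] := @submodule_finite s I.
  by split=> [|b u v uI vI]; case: Iid => [//] _; apply.
exists t => x; split; first by move/It/module_span_ideal_gen.
exact: ideal_gen_closed.
Qed.

(* For [x] in [q] but not in [p], the constant coefficient of a shortest
   integral equation of [x] modulo [p] lies in [q] but not in [p]. *)
Lemma contraction_lt (p q : prime_idealr R) :
  ideal_lt p q -> exists2 f, phi f \in q & phi f \notin p.
Proof.
move=> /ideal_ltP[pq [x xq xp]].
have [h hmon /eqP hx] := module_finite_integral gen x.
(* In place of choosing a shortest equation, the induction strips constant terms lying in [p],
   dividing by [x] modulo [p]. *)
have {hx} : (map_poly phi h).[x] \in p by rewrite hx idealr0.
elim/poly_ind: h hmon => [|h c IHh].
  by rewrite monicE lead_coef0 eq_sym oner_eq0.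
rewrite rmorphD rmorphM /= map_polyX map_polyC /= hornerMXaddC => hmon hxp.
have [cp|cp] := boolP (phi c \in p); last first.
  exists c => //; rewrite -[phi c](addKr ((map_poly phi h).[x] * x)) rpredD //.
    by rewrite rpredN idealMr.
  exact: pq.
have: (map_poly phi h).[x] * x \in p by rewrite -[_ * _](addrK (phi c)) rpredB.
rewrite prime_idealrM (negPf xp) orbF; apply: IHh.
have [h0|h0] := eqVneq h 0; last first.
  move: hmon; rewrite !monicE lead_coefDl ?lead_coefMX //.
  rewrite size_mulX // size_polyC ltnS (leq_trans (leq_b1 _)) //.
  by rewrite lt0n size_poly_eq0.
move: hmon cp; rewrite h0 mul0r add0r monicE lead_coefC => /eqP->.
by rewrite rmorph1 idealr1.
Qed.

(** The contraction of [q] to K[z] is a nonzero prime (g), hence maximal, whereas [r] contracts to a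
    proper ideal that is strictly larger. *)
Lemma finite_dim_le1 : dim_le1 R.
Proof.
move=> p q r pq qr; have [f fq fp] := contraction_lt pq.
have [h hr hq] := contraction_lt qr.
pose J : {pred {poly K}} := fun f => phi f \in q.
have JE u : (u \in J) = (phi u \in q) by [].
have [|g] := @poly_ideal_principal J.
  split=> [|a u v]; rewrite !JE ?rmorph0 ?idealr0 // rmorphD rmorphM => uq vq.
  by rewrite rpredD // idealMr.
rewrite JE => gq gdvd.
have g0 : g != 0.
  apply: contraNneq fp => g0; have := gdvd f fq.
  by rewrite g0 dvd0p => /eqP->; rewrite rmorph0 idealr0.
have [[u v] /= uv] := Bezoutp g h.
have dr : phi (gcdp g h) \in r.
  have /dvdpP[w ->] : u * g + v * h %| gcdp g h by rewrite (eqp_dvdl _ uv).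
  rewrite rmorphM rmorphD !rmorphM idealMr // rpredD // idealMr //.
  by case: qr => qr _; apply: qr.
have /dvdpP[w gE] := dvdp_gcdl g h.
have : phi w * phi (gcdp g h) \in q by rewrite -rmorphM -gE.
(* If the gcd is in [q], so is [h]. If [w] is, then g divides [w], so the gcd is a unit, although it
   lies in [r]. *)
rewrite prime_idealrM => /orP[wq|dq]; last first.
  have /dvdpP[z hE] := dvdp_gcdr g h.
  by move: hq; rewrite hE rmorphM idealMr.
have /dvdpP[z wE] := gdvd w wq.
have zd : z * gcdp g h = 1.
  by apply: (mulIf g0); rewrite mul1r [RHS]gE wE; ring.
by have := idealr1 r; rewrite -(rmorph1 phi) -zd rmorphM idealMr.
Qed.

(* If [phi 'X] has an inverse [r] modulo [m], multiplying an integral equation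
   of [r] by a power of ['X] produces a polynomial with constant term [1] that
   [phi] maps into [m]. *)
Lemma maximal_contraction (m : prime_idealr R) :
  maximal_ideal m -> exists2 f, f != 0 & phi f \in m.
Proof.
move=> mmax; have [Xm|Xm] := boolP (phi 'X \in m).
  by exists 'X; rewrite ?polyX_eq0.
have [r rm] : exists r, r * phi 'X - 1 \in m.
  apply: contrapT => no.
  (* The ideal [m] + ([phi 'X]), proper if [phi 'X] has no inverse modulo [m]. *)
  pose I : {pred R} := fun x => `[< exists r, r * phi 'X - x \in m >].
  have Iid : idealr_closed I.
    split; first by apply/asboolP; exists 0; rewrite mul0r subr0 idealr0.
      exact/asboolP.
    move=> a x y /asboolP[r rx] /asboolP[r' ry].
    apply/asboolP; exists (a * r + r').
    have -> : (a * r + r') * phi 'X - (a * x + y) =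
      a * (r * phi 'X - x) + (r' * phi 'X - y) by ring.
    by rewrite rpredD // idealMr.
  pose Ii : idealr R := HB.pack I (isIdealr.Build R I Iid).
  move/negP: Xm; apply; apply: (mmax Ii).
    by move=> x xm; apply/asboolP; exists 0; rewrite mul0r sub0r rpredN.
  by apply/asboolP; exists 1; rewrite mul1r subrr idealr0.
have [q qmon /eqP qr] := module_finite_integral gen r.
pose n := (size q).-1.
have sizeq : size q = n.+1 by rewrite prednK // size_poly_gt0 monic_neq0.
(* The reversal of [q]: its constant term is the leading coefficient 1 of [q]. *)
pose f := \sum_(i < n.+1) q`_i * 'X^(n - i).
have qn : q`_n = 1 by move: qmon => /monicP; rewrite lead_coefE.
have f1 : f.[0] = 1.
  rewrite horner_sum big_ord_recr /= subnn expr0 mulr1 qn hornerE.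
  rewrite big1 ?add0r // => i _.
  by rewrite hornerM hornerXn expr0n subn_eq0 leqNgt ltn_ord mulr0.
exists f.
  by apply: contra_eq_neq f1 => ->; rewrite horner0 eq_sym oner_eq0.
have -> : phi f = phi f - phi 'X ^+ n * (map_poly phi q).[r].
  by rewrite qr mulr0 subr0.
rewrite (@horner_coef_wide _ n.+1) -?[X in (_ <= X)%N]sizeq ?size_poly //.
rewrite /f rmorph_sum mulr_sumr -sumrB rpred_sum // => i _.
(* Each term is a multiple of a difference between a power of [r * phi 'X] and 1, which lies in
   [m]. *)
have -> : phi (q`_i * 'X^(n - i)) -
    phi 'X ^+ n * ((map_poly phi q)`_i * r ^+ i) =
  - (phi q`_i * phi 'X ^+ (n - i)) * ((r * phi 'X) ^+ i - 1).
  have -> : phi 'X ^+ n = phi 'X ^+ (n - i) * phi 'X ^+ i.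
    by rewrite -exprD subnK // -ltnS.
  by rewrite coef_map /= rmorphM rmorphXn exprMn; ring.
by rewrite subrX1 mulrCA mulrC idealMr.
Qed.

(** The lower prime avoids the images of all nonzero polynomials, which are nonzero by torsion
    freeness; the upper one contains such an image because [m] contains one. *)
Lemma finite_torsion_free_loc_chain (m : prime_idealr R) :
  maximal_ideal m -> exists p q : prime_idealr (localization m), ideal_lt p q.
Proof.
move=> mmax; have [f f0 fm] := maximal_contraction mmax.
have [||q qmax _] := @exists_maximal_above _ (loc_max m).
- exact: idealr_ideal_closed.
- by rewrite idealr1.
have [||_ _ [g [g0 ->]] [h [h0 ->]]|x [g [g0 ->]]|p [_ pS _]] :=
  @exists_prime_avoiding (localization m) (pred1 0)
  (fun x => exists g, g != 0 /\ x = to_loc m (phi g)).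
- exact: ideal_closed0.
- by exists 1; rewrite oner_eq0 !rmorph1.
- by exists (g * h); rewrite mulf_neq0 // !rmorphM.
- rewrite inE; apply/eqP => /to_loc_eq0[u um].
  by rewrite mulrC => /(phi_regular g0) u0; rewrite u0 idealr0 in um.
exists p, q; apply/ideal_ltP; split.
  by move=> x /(loc_max_local (I := p)); apply: qmax.
exists (to_loc m (phi f)); first by apply/qmax/to_loc_max.
by apply: pS; exists f.
Qed.

Theorem finite_torsion_free_krull_dim : krull_dim R 1.
Proof.
have [|m _ mmax] := exists_maximal_above (@ideal_closed0 R).
  by rewrite inE oner_eq0.
have [p [q pq]] := finite_torsion_free_loc_chain mmax.
exact: krull_dim1 finite_dim_le1 (preim_to_loc_lt pq).
Qed.

Theorem finite_torsion_free_cohen_macaulay : cohen_macaulay R.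
Proof.
split=> [|m mmax]; first exact: finite_noetherian.
have dim := loc_dim_le1 (p := m) finite_dim_le1.
have [f f0 fm] := maximal_contraction mmax.
exists (loc_max m); split; first exact: loc_max_local.
exists 1%N; split.
  apply: (depth1 (a := to_loc m (phi f))) => //; first exact: loc_max_local.
    exact: to_loc_max.
  by move=> z; apply: to_loc_regular => x; apply: phi_regular.
have [p [q pq]] := finite_torsion_free_loc_chain mmax.
exact: krull_dim1 dim pq.
Qed.

End PolynomialModules.

(** * Normal forms in the squarefree basis over K[y] *)

Section NormalForm.
Variables (K : fieldType) (n : nat).

(** The power of y that splits off when every squared variable in the monomial is replaced by y;
    [mnm_parity] is the squarefree remainder. *)
Definition mnm_half (m : 'X_{1..n}) : nat := (\sum_i (m i)./2)%N.
Definition mnm_parity (m : 'X_{1..n}) : 'X_{1..n} :=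
  [multinom nat_of_bool (odd (m i)) | i < n].

Definition nf_mnm (m : 'X_{1..n}) : {mpoly {poly K}[n]} :=
  'X^(mnm_half m) *: 'X_[mnm_parity m].

(* [nf p] is the coordinate vector of the class of [p] in the squarefree basis
   over K[y]; the class y of every squared variable is ['X] in [{poly K}]. *)
Definition nf (p : {mpoly K[n]}) : {mpoly {poly K}[n]} :=
  \sum_(m <- msupp p) (p@_m)%:P *: nf_mnm m.

(** A summation range common to several polynomials, so that linearity can be checked termwise. *)
Lemma nfwE (p : {mpoly K[n]}) k : (msize p <= k)%N ->
  nf p = \sum_(m : 'X_{1..n < k}) (p@_m)%:P *: nf_mnm m.
Proof.
move=> le_pk; set I : subFinType _ := 'X_{1..n < k}.
rewrite /nf (big_mksub I) ?msupp_uniq //=; first last.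
  by move=> m /msize_mdeg_lt /leq_trans; apply.
rewrite big_rmcond //= => j /memN_msupp_eq0 ->.
by rewrite polyC0 scale0r.
Qed.

Lemma nf_zmod : zmod_morphism nf.
Proof.
move=> p q; pose_big_enough k.
  rewrite !(@nfwE _ k) // -sumrB; apply: eq_bigr => m _.
  by rewrite mcoeffB polyCB scalerBl.
by close.
Qed.

HB.instance Definition _ :=
  GRing.isZmodMorphism.Build {mpoly K[n]} {mpoly {poly K}[n]} nf nf_zmod.

Lemma nfZ c p : nf (c *: p) = c%:P *: nf p.
Proof.
pose_big_enough k.
  rewrite !(@nfwE _ k) // scaler_sumr; apply: eq_bigr => m _.
  by rewrite mcoeffZ polyCM scalerA.
by close.
Qed.

Lemma nfX m : nf 'X_[m] = nf_mnm m.
Proof. by rewrite /nf msuppX big_seq1 mcoeffX eqxx scale1r. Qed.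

Lemma nf1 : nf 1 = 1.
Proof.
rewrite -mpolyX0 nfX /nf_mnm /mnm_half big1 ?expr0 ?scale1r => [|i _].
  rewrite -mpolyX0; congr 'X_[_]; apply/mnmP => i.
  by rewrite mnmE mnm0E.
by rewrite mnm0E.
Qed.

(** On monomials: raising one exponent by two adds one to [mnm_half] and preserves all parities. *)
Lemma nf_mulX2 i p : nf ('X_i ^+ 2 * p) = 'X *: nf p.
Proof.
elim/mpolyind: p => [|c m p _ _ IHp]; first by rewrite mulr0 raddf0 scaler0.
rewrite mulrDr !raddfD /= IHp -scalerAr !nfZ; congr (_ + _).
rewrite scalerA [_ * c%:P]mulrC -scalerA; congr (_ *: _).
rewrite expr2 -mulrA -!mpolyXD !nfX /nf_mnm scalerA -exprS.
congr (_ ^+ _ *: 'X_[_]).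
  rewrite /mnm_half (bigD1 i) //= [in RHS](bigD1 i) //= -addSn.
  congr (_ + _)%N; first by rewrite !mnmDE mnm1E eqxx.
  by apply: eq_bigr => j ji; rewrite !mnmDE mnm1E eq_sym (negPf ji).
by apply/mnmP => j; rewrite !mnmE; case: eqP => _; rewrite //= negbK.
Qed.

End NormalForm.

(** * The kernel of the normal form is the ideal of square differences *)

Section SquareDifferences.
Variables (K : fieldType) (V : finType).
Local Notation J := (ideal_gen (square_differences K V)).

Lemma nf_square_differences p : J p -> nf p = 0.
Proof.
move=> [c ->]; rewrite raddf_sum big1 // => i _.
have := mem_nth 0 (ltn_ord i); set x := _`_i => /allpairsP[[a b] [_ _ ->]] /=.
by rewrite mulrC mulrBl raddfB /= !nf_mulX2 subrr.
Qed.

Definition sqdiff_ideal : {pred {mpoly K[#|V|]}} := fun p => `[< J p >].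

Lemma sqdiff_idealr_closed : idealr_closed sqdiff_ideal.
Proof.
split.
- by apply/asboolP; exists (fun=> 0); rewrite big1 // => i _; rewrite mul0r.
- by apply/asboolP => /nf_square_differences/eqP; rewrite nf1 oner_eq0.
- move=> a u v /asboolP[c ->] /asboolP[d ->]; apply/asboolP.
  exists (fun i => a * c i + d i).
  by rewrite mulr_sumr -big_split; apply: eq_bigr => i _; rewrite mulrDl mulrA.
Qed.

HB.instance Definition _ := isIdealr.Build _ sqdiff_ideal sqdiff_idealr_closed.

(** The class of [p] modulo the ideal can be recovered from [nf p]: [sigma] substitutes the class of
    the square at [a] for y and the classes of the variables for the variables. *)
Lemma nf_eq0 (a : V) p : nf p = 0 -> J p.
Proof.
pose Q := {ideal_quot (sqdiff_ideal : idealr _)}.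
pose y : {mpoly K[#|V|]} := vertex_var K a ^+ 2.
have yE (i : 'I_#|V|) : \pi_Q ('X_i ^+ 2) = \pi_Q y :> Q.
  apply/eqP; rewrite -Quotient.idealrBE; apply/asboolP.
  have : 'X_i ^+ 2 - y \in square_differences K V.
    apply/allpairsP; exists (enum_val i, a); rewrite !mem_enum.
    by rewrite /vertex_var enum_valK.
  move=> /(nthP 0)[k ltk <-]; exists (fun j => (j == Ordinal ltk)%:R).
  rewrite (bigD1 (Ordinal ltk)) //= eqxx mul1r big1 ?addr0 // => j /negPf->.
  by rewrite mul0r.
pose g : {rmorphism {poly K} -> Q} := \pi_Q \o horner_alg y.
pose sigma := mmap g (fun i => \pi_Q 'X_i).
have sigmaK : sigma (nf p) = \pi_Q p :> Q.
  rewrite [in RHS](mpolyE p) /sigma /nf !raddf_sum; apply: eq_bigr => m _.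
  rewrite /= !mmapZ mmapX /= -mul_mpolyC horner_algC.
  rewrite rmorphM rmorphXn /= horner_algX.
  congr (_ * _); first by rewrite -mul_mpolyC mulr1.
  rewrite rmorphXn /mmap1 mpolyXE_id rmorph_prod /= /mnm_half -prodrXr.
  rewrite -big_split /=.
  apply: eq_bigr => i _.
  rewrite -(yE i) -!rmorphXn -rmorphM -exprM -exprD.
  congr (\pi_Q (_ ^+ _)).
  by rewrite mnmE addnC mul2n odd_double_half.
move=> p0; move: sigmaK; rewrite p0 /sigma raddf0 => /esym/eqP.
rewrite -[0](rmorph0 \pi_Q) -Quotient.idealrBE subr0 => /asboolP; exact.
Qed.

End SquareDifferences.

(** * The edge quotient as a finite torsion-free K[z]-module *)

Section EdgeRingTheory.
Variables (K : fieldType) (V : finType) (e : rel V).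
Hypothesis irr : irreflexive e.
Local Notation S := {mpoly K[#|edges e|]}.
Local Notation Q := {ideal_quot (IX K e)}.
Local Notation theta := (@Defs.theta K V e).

Lemma theta_zmod : zmod_morphism theta.
Proof. by move=> p q; rewrite /Defs.theta rmorphB. Qed.

Lemma theta_monoid : monoid_morphism theta.
Proof. by split=> [|p q]; rewrite /Defs.theta ?rmorph1 ?rmorphM. Qed.

HB.instance Definition _ := GRing.isZmodMorphism.Build S {mpoly K[#|V|]}
  theta theta_zmod.
HB.instance Definition _ := GRing.isMonoidMorphism.Build S {mpoly K[#|V|]}
  theta theta_monoid.

Lemma edgeP (k : 'I_#|edges e|) :
  exists i j, e i j /\ enum_val k = [set i; j].
Proof.
have /imsetP[[i j] /= eij ->] := enum_valP k.
by exists i, j; split; rewrite // inE in eij.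
Qed.

Lemma mem_IX (k : 'I_#|edges e|) (p : S) : (p \in IX K e) <-> nf (theta p) = 0.
Proof.
(* An endpoint of the edge is the base vertex that [nf_eq0] asks for. *)
have [i _] := edgeP k.
by split=> [/asboolP|p0]; [apply: nf_square_differences|apply/asboolP/nf_eq0].
Qed.

Lemma nf_theta_mulX2 k q : nf (theta ('X_k ^+ 2) * q) = 'X^2 *: nf q.
Proof.
have [i [j [eij kE]]] := edgeP k.
by rewrite rmorphXn /= (thetaX _ irr eij kE) exprMn -mulrA !nf_mulX2 scalerA.
Qed.

Definition edge_pi : {rmorphism S -> edge_quotient K e} := \pi_Q.

Lemma edge_pi_surj x : exists p, x = edge_pi p.
Proof. by exists (repr (x : Q)); rewrite /edge_pi /= reprK. Qed.

Lemma edge_pi_eq0 (k : 'I_#|edges e|) p : edge_pi p = 0 <-> nf (theta p) = 0.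
Proof.
rewrite -(mem_IX k) -[p in p \in _]subr0 Quotient.idealrBE -(rmorph0 edge_pi).
by split=> /eqP.
Qed.

Lemma edge_sqr_eq k l : edge_pi 'X_k ^+ 2 = edge_pi 'X_l ^+ 2.
Proof.
apply/eqP; rewrite -subr_eq0 -!rmorphXn -rmorphB; apply/eqP/(edge_pi_eq0 k).
rewrite rmorphB raddfB /= -[theta ('X_k ^+ 2)]mulr1 -[theta ('X_l ^+ 2)]mulr1.
by rewrite !nf_theta_mulX2 subrr.
Qed.

Variable k0 : 'I_#|edges e|.

(** The K[z]-algebra structure, with z the common class of all squared edge variables. *)
Definition edge_param : {rmorphism {poly K} -> edge_quotient K e} :=
  edge_pi \o horner_alg ('X_k0 ^+ 2 : S).

(** An edge variable squared maps to a product of two squared vertex variables, so z acts on normal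
    forms as the square of y. *)
Lemma nf_theta_horner (f : {poly K}) q :
  nf (theta (horner_alg ('X_k0 ^+ 2 : S) f) * q) = (f \Po 'X^2) *: nf q.
Proof.
elim/poly_ind: f q => [|f c IHf] q.
  by rewrite rmorph0 comp_poly0 rmorph0 mul0r raddf0 scale0r.
rewrite comp_poly_MXaddC scalerDl rmorphD rmorphM /= horner_algX horner_algC.
rewrite rmorphD rmorphM mulrDl raddfD /= -mulrA IHf nf_theta_mulX2 scalerA.
congr (_ + _).
have -> : theta (c%:A : S) = c%:A by rewrite /Defs.theta linearZ rmorph1.
by rewrite -scalerAl mul1r nfZ.
Qed.

(** Normal forms have coefficients in the domain K[y], where substituting the square of y into a
    nonzero [f] gives a nonzero scalar. *)
Lemma edge_param_regular f x : f != 0 -> edge_param f * x = 0 -> x = 0.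
Proof.
move=> f0; have [p ->] := edge_pi_surj x.
rewrite /edge_param /= -rmorphM !(edge_pi_eq0 k0) rmorphM.
rewrite nf_theta_horner => /eqP.
rewrite -mul_mpolyC mulf_eq0 mpolyC_eq0 comp_poly_eq0 ?size_polyXn //.
by rewrite (negPf f0) => /eqP.
Qed.

Definition edge_mon (A : {set 'I_#|edges e|}) : edge_quotient K e :=
  \prod_(k in A) edge_pi 'X_k.

Definition edge_mons : seq (edge_quotient K e) := codom edge_mon.

(** Multiplying a squarefree monomial by an edge variable either adds a new factor or produces a
    square, which is the scalar z. *)
Lemma mul_edge_span k x :
  module_span edge_param edge_mons x ->
  module_span edge_param edge_mons (edge_pi 'X_k * x).
Proof.
move=> [c ->]; rewrite mulr_sumr; elim/big_ind: _ => [|u v|i _].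
- exact: module_span0.
- exact: module_spanD.
rewrite mulrCA; apply: module_spanM.
have /codomP[A ->] := mem_nth 0 (ltn_ord i).
have [kA|kA] := boolP (k \in A); last first.
  by rewrite /edge_mon -big_setU1 //; apply/mem_module_span/codom_f.
have -> : edge_pi 'X_k * edge_mon A = edge_param 'X * edge_mon (A :\ k).
  rewrite /edge_mon (big_setD1 k) //= mulrA -expr2 (edge_sqr_eq k k0).
  by rewrite /edge_param /= horner_algX rmorphXn.
exact/module_spanM/mem_module_span/codom_f.
Qed.

Lemma edge_quotient_span x : module_span edge_param edge_mons x.
Proof.
have [p ->] := edge_pi_surj x.
elim/mpolyind: p => [|c m p _ _ IHp].
  by rewrite rmorph0; apply: module_span0.
rewrite rmorphD; apply: module_spanD => //.
rewrite -mul_mpolyC rmorphM.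
have -> : edge_pi c%:MP = edge_param c%:P.
  by rewrite /edge_param /= horner_algC -mul_mpolyC mulr1.
apply: module_spanM; rewrite mpolyXE_id rmorph_prod.
(* Generalized from 1 to any [y] in the span, so that variables can be multiplied in one at a
   time. *)
suff mulP (r : seq 'I_#|edges e|) y : module_span edge_param edge_mons y ->
    module_span edge_param edge_mons (\prod_(i <- r) edge_pi ('X_i ^+ m i) * y).
  rewrite -[X in module_span _ _ X]mulr1; apply/mulP/mem_module_span/codomP.
  by exists set0; rewrite /edge_mon big_set0.
elim: r y => [|i r IHr] y sy; first by rewrite big_nil mul1r.
rewrite big_cons -mulrA rmorphXn; elim: (m i) => [|d IHd].
  by rewrite mul1r; apply: IHr.
by rewrite exprS -mulrA; apply: mul_edge_span.
Qed.

End EdgeRingTheory.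

Theorem proposition2p1 (K : fieldType) (V : finType) (e : rel V) :
  (0 < #|V|)%N -> symmetric e -> irreflexive e ->
  (forall i : V, exists j : V, e i j) ->
  krull_dim (edge_quotient K e) 1 /\ cohen_macaulay (edge_quotient K e).
Proof.
(* A vertex and its neighbour give the edge whose squared variable serves as z. *)
move=> /card_gt0P[i _] _ irr /(_ i)[j eij].
have kE : [set i; j] \in edges e by apply/imsetP; exists (i, j); rewrite ?inE.
pose k := enum_rank_in kE [set i; j].
have reg := edge_param_regular (K := K) irr (k0 := k).
have gen := edge_quotient_span (K := K) irr k.
split; first exact: (finite_torsion_free_krull_dim reg gen).
exact: (finite_torsion_free_cohen_macaulay reg gen).
Qed.
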